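(* Let $p\geq 1$ be an integer and $(a_n)_{n\in\mathbb{Z}}$ a bi-infinite sequence of complex numbers (or indeterminates). With the collections of paths and weight polynomials defined in the context, for every $m\in\mathbb{Z}_{\geq 0}$ and $0\leq j\leq p$: \begin{align*} R_{[m(p+1)+j,j]} &=\sum_{i_{1}=-p}^{(m-1)p+j}\,\sum_{i_{2}=i_{1}-p}^{(m-2)p+j}\,\sum_{i_{3}=i_{2}-p}^{(m-3)p+j}\cdots\sum_{i_{m}=i_{m-1}-p}^{j}\,\prod_{k=1}^{m}a_{i_{k}},\\ S_{[m(p+1)+j,j]} &=\sum_{i_{1}=0}^{j}\,\sum_{i_{2}=0}^{i_{1}+p}\,\sum_{i_{3}=0}^{i_{2}+p}\cdots\sum_{i_{m}=0}^{i_{m-1}+p}\,\prod_{k=1}^{m}a_{i_{k}},\\ T_{[m(p+1)+j,j]} &=\sum_{i_{1}=-j-p}^{-p}\,\sum_{i_{2}=i_{1}-p}^{-p}\,\sum_{i_{3}=i_{2}-p}^{-p}\cdots\sum_{i_{m}=i_{m-1}-p}^{-p}\,\prod_{k=1}^{m}a_{i_{k}}, \end{align*} where each right-hand side is understood to be $1$ when $m=0$.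
   Context: Consider lattice paths with vertices in $\mathbb{Z}_{\geq0}\times\mathbb{Z}$, given as finite sequences of steps (consecutive steps sharing endpoints), where only two kinds of steps are allowed: upsteps $(n,m)\to(n+1,m+1)$, of weight $1$, and downsteps $(n,m)\to(n+1,m-p)$ (down by exactly $p$ units), of weight $a_{m-p}$. The length of a path is its number of steps; its weight $w(\gamma)$ is the product of the weights of its steps ($1$ for a path of length $0$). $\min(\gamma)$, $\max(\gamma)$ are the minimal and maximal heights of its vertices. For $n\geq0$ and $0\leq j\leq p$: $\mathcal{R}_{[n,j]}$ is the set of such paths of length $n$ from $(0,0)$ to $(n,j)$; $\mathcal{S}_{[n,j]}$ is the set of paths in $\mathcal{R}_{[n,j]}$ with $\min(\gamma)=0$; $\widehat{\mathcal{S}}_{[n,j]}$ is the set of such paths of length $n$ from $(0,-j)$ to $(n,0)$ with $\max(\gamma)=0$. Define $R_{[n,j]}=\sum_{\gamma\in\mathcal{R}_{[n,j]}}w(\gamma)$, $S_{[n,j]}=\sum_{\gamma\in\mathcal{S}_{[n,j]}}w(\gamma)$, $T_{[n,j]}=\sum_{\gamma\in\widehat{\mathcal{S}}_{[n,j]}}w(\gamma)$. *)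

(* Defs.v *)
From mathcomp Require Import all_boot all_order all_algebra.
From mathcomp Require Import boolp classical_sets cardinality fsbigop.

Set Implicit Arguments.
Unset Strict Implicit.
Unset Printing Implicit Defensive.

Import Order.TTheory GRing.Theory Num.Theory.

Local Open Scope classical_set_scope.
Local Open Scope ring_scope.

Notation vertex := (nat * int)%type (only parsing).

(* A path is its initial vertex together with the endpoints of its successive
   steps; in this way a path of length 0 still has a vertex. *)
Notation lpath := (vertex * seq vertex)%type (only parsing).

Definition upstep (u v : vertex) : bool := v == (u.1.+1, u.2 + 1).

Definition downstep (p : nat) (u v : vertex) : bool :=
  v == (u.1.+1, u.2 - p%:Z).

Definition is_lpath (p : nat) (g : lpath) : bool :=
  path (fun u v => upstep u v || downstep p u v) g.1 g.2.

Definition start (g : lpath) : vertex := g.1.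
Definition finish (g : lpath) : vertex := last g.1 g.2.
Definition len (g : lpath) : nat := size g.2.

Definition min_height (g : lpath) : int :=
  \big[Num.min/g.1.2]_(v <- g.2) v.2.

Definition max_height (g : lpath) : int :=
  \big[Num.max/g.1.2]_(v <- g.2) v.2.

(* Only used on steps (u, v) of a path, which are either upsteps or downsteps,
   and never both. *)
Definition step_weight (K : comNzRingType) (p : nat) (a : int -> K)
    (u v : vertex) : K :=
  if upstep u v then 1 else a (u.2 - p%:Z).

Definition weight (K : comNzRingType) (p : nat) (a : int -> K)
    (g : lpath) : K :=
  \prod_(x <- pairmap (step_weight p a) g.1 g.2) x.

Definition paths_between (p n : nat) (u v : vertex) : set lpath :=
  [set g | [/\ is_lpath p g, len g = n, start g = u & finish g = v]].

Definition Rpaths (p n j : nat) : set lpath :=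
  paths_between p n (0%N, 0) (n, j%:Z).

Definition Spaths (p n j : nat) : set lpath :=
  [set g | Rpaths p n j g /\ min_height g = 0].

Definition hatSpaths (p n j : nat) : set lpath :=
  [set g | paths_between p n (0%N, - j%:Z) (n, 0) g /\ max_height g = 0].

(* The sum over a set, [\sum_(g \in A)], is meaningful only for finite
   support; all the path sets above are finite. *)
Lemma finite_paths_between (p n : nat) (u v : vertex) :
  finite_set (paths_between p n u v).
Proof.
pose e := fun x y => upstep x y || downstep p x y.
have fin : forall k (x : vertex),
    finite_set [set s : seq vertex | path e x s /\ size s = k].
  elim=> [|k IHk] x.
    apply: (@sub_finite_set _ _ [set [::]]); last exact: finite_set1.
    by move=> s /= [_ /size0nil].
  pose y := (x.1.+1, x.2 + 1) : vertex.
  pose z := (x.1.+1, x.2 - p%:Z) : vertex.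
  have fyz := conj (finite_image (cons y) (IHk y))
                   (finite_image (cons z) (IHk z)).
  rewrite -finite_setU in fyz.
  apply: (sub_finite_set _ fyz).
  case=> [[]//|w s] /= [/andP[/orP[] /eqP-> es] [<-]].
    by left; exists s.
  by right; exists s.
apply: (sub_finite_set _ (finite_image (pair u) (fin n u))).
by case=> x s [/= es ls <- _]; exists s.
Qed.

Lemma finite_Rpaths (p n j : nat) : finite_set (Rpaths p n j).
Proof. exact: finite_paths_between. Qed.

Lemma finite_Spaths (p n j : nat) : finite_set (Spaths p n j).
Proof. by apply: (sub_finite_set _ (finite_Rpaths p n j)) => g []. Qed.

Lemma finite_hatSpaths (p n j : nat) : finite_set (hatSpaths p n j).
Proof.
apply: (sub_finite_set _ (finite_paths_between p n (0%N, - j%:Z) (n, 0))).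
by move=> g [].
Qed.

Definition Rpoly (K : comNzRingType) (p : nat) (a : int -> K) (n j : nat) : K :=
  \sum_(g \in Rpaths p n j) weight p a g.

Definition Spoly (K : comNzRingType) (p : nat) (a : int -> K) (n j : nat) : K :=
  \sum_(g \in Spaths p n j) weight p a g.

Definition Tpoly (K : comNzRingType) (p : nat) (a : int -> K) (n j : nat) : K :=
  \sum_(g \in hatSpaths p n j) weight p a g.

(* The integers lo, lo + 1, ..., hi (none if hi < lo). *)
Definition int_range (lo hi : int) : seq int :=
  if lo <= hi then [seq lo + k%:Z | k <- iota 0 `|hi - lo|%N.+1] else [::].

(* [nested_sum lo hi F r s] performs [r] further nested summations after the
   indices in [s] (outermost first) have been chosen, then evaluates [F] at the
   list of all indices; the bounds of each sum may depend on the indices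
   already chosen. *)
Fixpoint nested_sum (K : comNzRingType) (lo hi : seq int -> int)
    (F : seq int -> K) (r : nat) (s : seq int) : K :=
  if r is r'.+1 then
    \sum_(i <- int_range (lo s) (hi s)) nested_sum lo hi F r' (rcons s i)
  else F s.

(* In the three bounds using [last i0 s], the index i_k (k >= 1) is bounded in
   terms of i_(k-1), where i_0 := i0 is chosen so as to give the stated bound
   for i_1. *)
Definition Rsum (K : comNzRingType) (p : nat) (a : int -> K) (m j : nat) : K :=
  nested_sum (fun s => last 0 s - p%:Z)
             (fun s => (m%:Z - (size s).+1%:Z) * p%:Z + j%:Z)
             (fun s => \prod_(i <- s) a i) m [::].

Definition Ssum (K : comNzRingType) (p : nat) (a : int -> K) (m j : nat) : K :=
  nested_sum (fun=> 0)
             (fun s => last (j%:Z - p%:Z) s + p%:Z)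
             (fun s => \prod_(i <- s) a i) m [::].

Definition Tsum (K : comNzRingType) (p : nat) (a : int -> K) (m j : nat) : K :=
  nested_sum (fun s => last (- j%:Z) s - p%:Z)
             (fun=> - p%:Z)
             (fun s => \prod_(i <- s) a i) m [::].

(* Main.v *)
Require Import Defs.
From mathcomp Require Import all_boot all_order all_algebra.
From mathcomp Require Import boolp classical_sets fsbigop.
From mathcomp Require Import zify ring.

(** Let [u] be the number of steps going up and [d] the number of steps going
    down of a path from height [h] to height [k].  The length [u + d] and the
    height difference [u - p * d] determine [d], so the sum of the weights of
    the paths of given length satisfies, by removing the first step, the same
    recursion in [h] as the nested sum with [d] levels whose lower bound is
    [h - p]: a path starting with a downstep contributes to the term
    [i = h - p] of the outermost sum, and one starting with an upstep to the
    remaining terms, which form the same sum with [h + 1] in place of [h].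
    This gives the formulas for R and T.  Reversing and negating a path turns
    nonnegative paths from [0] to [j] into nonpositive paths from [-j] to [0],
    with [a] replaced by [a (- x - p)], and S follows from T. *)

Set Implicit Arguments.
Unset Strict Implicit.
Unset Printing Implicit Defensive.

Import Order.TTheory GRing.Theory Num.Theory.

Local Open Scope ring_scope.

Section Enumeration.
Variable p : nat.

Fixpoint step_seqs (n : nat) (x : vertex) : seq (seq vertex) :=
  if n is n'.+1 then
    let y := (x.1.+1, x.2 + 1) in
    let z := (x.1.+1, x.2 - p%:Z) in
    map (cons y) (step_seqs n' y) ++ map (cons z) (step_seqs n' z)
  else [:: [::]].

Lemma mem_step_seqs n x s :
  (s \in step_seqs n x) = is_lpath p (x, s) && (size s == n).
Proof.
rewrite /is_lpath /=; elim: n x s => [|n IHn] x [|w s] //=.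
- by rewrite andbF.
- by rewrite mem_cat; apply/negbTE/norP; split; apply/mapP => -[].
have memc (y : vertex) :
    ((w :: s) \in map (cons y) (step_seqs n y)) =
      (w == y) && (s \in step_seqs n y).
  apply/mapP/andP => [[t tin [-> ->]]|[/eqP-> sin]]; first by rewrite eqxx.
  by exists s.
rewrite mem_cat !memc eqSS !IHn -andbA /upstep /downstep.
rewrite andb_orl; congr (_ || _).
  by have [->|] := eqVneq w (_, x.2 + 1).
by have [->|] := eqVneq w (_, x.2 - _).
Qed.

Lemma step_seqs_uniq n x : uniq (step_seqs n x).
Proof.
elim: n x => [|n IHn] x //=.
have consI (y : vertex) : injective (cons y) by move=> s t [].
rewrite cat_uniq !(map_inj_uniq (consI _)) !IHn andbT /=.
by apply/hasPn => _ /mapP[s _ ->]; apply/mapP => -[t _ [] /eqP]; lia.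
Qed.

Lemma path_abscissa (x : vertex) s :
  is_lpath p (x, s) -> (last x s).1 = (x.1 + size s)%N.
Proof.
rewrite /is_lpath /=; elim: s x => [|w s IHs] x /=; first by rewrite addn0.
by case/andP=> /orP[]/eqP-> /IHs ->; rewrite addSnnS.
Qed.

End Enumeration.

Section PathSum.
Variables (K : comNzRingType) (p : nat).

Fixpoint path_sum (a : int -> K) (P : pred int) (n : nat) (h k : int) : K :=
  if n is n'.+1 then
    if P h then path_sum a P n' (h + 1) k
                + a (h - p%:Z) * path_sum a P n' (h - p%:Z) k
    else 0
  else (P h && (h == k))%:R.

Lemma path_sumE (a : int -> K) P n (x : vertex) k :
  \sum_(s <- step_seqs p n x
        | ((last x s).2 == k) && all (fun v => P v.2) (x :: s))
     weight p a (x, s) = path_sum a P n x.2 k.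
Proof.
elim: n x => [|n IHn] x /=.
  rewrite big_mkcond big_seq1 /= andbT andbC.
  by rewrite /weight /= big_nil; case: ifP.
case: ifP => Px /=; last by rewrite big1 // => s /andP[].
rewrite big_cat !big_map -(IHn (x.1.+1, x.2 + 1)) -(IHn (x.1.+1, x.2 - p%:Z)).
congr (_ + _).
  apply: eq_bigr => s _; rewrite /weight /= big_cons.
  by rewrite /step_weight /upstep eqxx mul1r.
rewrite mulr_sumr; apply: eq_bigr => s _; rewrite /weight /= big_cons.
by rewrite /step_weight /upstep ifN //; apply/eqP => -[]; lia.
Qed.

Lemma fsum_paths (a : int -> K) P n (h k : int) (A : set (vertex * seq vertex)) :
  (forall g, A g <-> paths_between p n (0%N, h) (n, k) g
                     /\ all (fun v => P v.2) (g.1 :: g.2)) ->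
  \sum_(g \in A) weight p a g = path_sum a P n h k.
Proof.
move=> AE; pose x : vertex := (0%N, h).
pose r := [seq g <- map (pair x) (step_seqs p n x)
          | (finish g == (n, k)) && all (fun v => P v.2) (g.1 :: g.2)].
have -> : A = [set` r]%classic.
  apply/seteqP; split=> -[y s].
    case/AE=> -[/= gp gs gx gf] gP; rewrite /= /r mem_filter /= gf gP eqxx /=.
    rewrite /start /= in gx; rewrite -/x in gx; rewrite -gx map_f //.
    by rewrite mem_step_seqs gp; apply/eqP.
  rewrite /= /r mem_filter => /andP[/andP[/eqP gf gP]] /mapP[t].
  rewrite mem_step_seqs => /andP[tp /eqP ts] [yx st].
  by apply/AE; split=> //; split; rewrite // ?yx ?st.
rewrite -fsbig_seq; last first.
  by rewrite filter_uniq // map_inj_uniq ?step_seqs_uniq // => s t [].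
rewrite big_filter big_map -(path_sumE a P n x).
rewrite big_seq_cond [RHS]big_seq_cond; apply: eq_bigl => s.
apply: andb_id2l; rewrite mem_step_seqs => /andP[/path_abscissa + /eqP sn].
rewrite sn /finish /=; case: (last x s) => [b c] /= ->.
by rewrite xpair_eqE add0n eqxx.
Qed.

Lemma path_sum_low (a : int -> K) P n (h k : int) :
  h + n%:Z < k -> path_sum a P n h k = 0.
Proof.
elim: n h => [|n IHn] h /= lt_hk.
  by rewrite (_ : h == k = false) ?andbF //; apply/eqP; lia.
by case: ifP => // _; rewrite !IHn ?mulr0 ?addr0 //; lia.
Qed.

Lemma path_sumSr (a : int -> K) P n (h k : int) :
  path_sum a P n.+1 h k =
  if P k then path_sum a P n h (k - 1) + a k * path_sum a P n h (k + p%:Z)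
  else 0.
Proof.
elim: n h => [|n IHn] h.
  rewrite /=; have [->|hk1] := eqVneq k (h + 1).
    rewrite addrK !eqxx (_ : (h - p%:Z == h + 1) = false); last by lia.
    rewrite (_ : (h == h + 1 + p%:Z) = false); last by lia.
    by rewrite !andbF !andbT !mulr0 !addr0; case: (P h); case: ifP.
  rewrite (_ : (h == k - 1) = false); last by lia.
  have [->|hkp] := eqVneq k (h - p%:Z).
    rewrite subrK !eqxx !andbF !andbT !add0r.
    by case: (P h); case: (P (h - _)); rewrite ?mulr0.
  rewrite (_ : (h == k + p%:Z) = false); last by lia.
  by rewrite !andbF !mulr0 !addr0; do 2!case: ifP.
rewrite -[LHS]/(if P h then path_sum a P n.+1 (h + 1) k
                 + a (h - p%:Z) * path_sum a P n.+1 (h - p%:Z) k else 0) !IHn.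
case: (P k); last by rewrite mulr0 addr0 if_same.
rewrite /=; case: ifP => _; last by rewrite mulr0 addr0.
ring.
Qed.

Lemma path_sum_rev (a : int -> K) P n (h k : int) :
  path_sum a P n h k =
  path_sum (fun x => a (- x - p%:Z)) (fun x => P (- x)) n (- k) (- h).
Proof.
elim: n h k => [|n IHn] h k.
  by rewrite /= opprK eqr_opp eq_sym; case: eqVneq => [->|]; rewrite ?andbF.
rewrite path_sumSr /= opprK; case: ifP => // _.
rewrite (IHn h (k - 1)) (IHn h (k + p%:Z)).
by congr (_ + a _ * _); last congr path_sum; rewrite ?opprD ?opprK ?addrK.
Qed.

End PathSum.

Lemma int_range_cons (lo hi : int) : lo <= hi ->
  int_range lo hi = lo :: int_range (lo + 1) hi.
Proof.
move=> le_lh; rewrite /int_range le_lh /= addr0; congr (_ :: _).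
rewrite (iotaDl 1 0) -map_comp; case: ifP => lt_lh.
  have -> : absz (hi - lo)%R = (absz (hi - (lo + 1))%R).+1 by lia.
  by apply: eq_map => i /=; lia.
by have -> : absz (hi - lo)%R = 0%N by lia.
Qed.

Lemma int_range0 (lo hi : int) : (lo <= hi) = false -> int_range lo hi = [::].
Proof. by rewrite /int_range => ->. Qed.

Lemma mem_int_range (lo hi i : int) : (i \in int_range lo hi) = (lo <= i <= hi).
Proof.
rewrite /int_range; case: ifP => le_lh; last by rewrite in_nil; lia.
apply/mapP/idP => [[n]|ilh]; first by rewrite mem_iota => ? ->; lia.
by exists (absz (i - lo)%R); rewrite ?mem_iota; lia.
Qed.

Lemma int_range_uniq (lo hi : int) : uniq (int_range lo hi).
Proof.
rewrite /int_range; case: ifP => // _; rewrite map_inj_uniq ?iota_uniq //.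
by move=> i j; lia.
Qed.

Lemma big_int_range_rev (V : nmodType) (c lo hi : int) (F : int -> V) :
  \sum_(i <- int_range lo hi) F i =
  \sum_(i <- int_range (c - hi) (c - lo)) F (c - i).
Proof.
rewrite -(big_map (fun i => c - i) xpredT); apply/perm_big/uniq_perm.
- exact: int_range_uniq.
- by rewrite map_inj_uniq ?int_range_uniq // => i j; lia.
move=> i; rewrite mem_int_range; apply/idP/mapP => [ilh|[j]].
  by exists (c - i); rewrite ?mem_int_range; lia.
by rewrite mem_int_range => jlh ->; lia.
Qed.

Section ChainSum.
Variable K : comNzRingType.

Fixpoint chain_sum (a : int -> K) (lo hi : nat -> int -> int) (r : nat)
    (x : int) : K :=
  if r is r'.+1 then
    \sum_(i <- int_range (lo r' x) (hi r' x)) a i * chain_sum a lo hi r' i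
  else 1.

Lemma nested_sumE (a : int -> K) (lo hi : seq int -> int)
    (lo' hi' : nat -> int -> int) (x0 : int) (m : nat) :
  (forall s r, (size s + r.+1 = m)%N -> lo s = lo' r (last x0 s)) ->
  (forall s r, (size s + r.+1 = m)%N -> hi s = hi' r (last x0 s)) ->
  nested_sum lo hi (fun s => \prod_(i <- s) a i) m [::]
  = chain_sum a lo' hi' m x0.
Proof.
move=> loE hiE.
suff nestedE r s : (size s + r = m)%N ->
    nested_sum lo hi (fun s => \prod_(i <- s) a i) r s
    = (\prod_(i <- s) a i) * chain_sum a lo' hi' r (last x0 s).
  by rewrite nestedE // big_nil mul1r.
elim: r s => [|r IHr] s sm /=; first by rewrite mulr1.
rewrite (loE _ _ sm) (hiE _ _ sm) mulr_sumr; apply: eq_bigr => i _.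
by rewrite IHr ?size_rcons ?addSnnS // last_rcons -cats1 big_cat big_seq1 mulrA.
Qed.

End ChainSum.

Section Comparison.
Variables (K : comNzRingType) (p : nat) (a : int -> K) (P : pred int) (k : int).
Variable hi : nat -> int.
Hypothesis Pk : P k.
Hypothesis P_le : forall x y : int, x <= y -> P y -> P x.
Hypothesis hiP : forall (r : nat) (h : int),
  (h - p%:Z <= hi r) = P h && (h - p%:Z <= r%:Z * p%:Z + k).

Lemma path_sum_chain (n r : nat) (h : int) : h + n%:Z = k + r%:Z * (p%:Z + 1) ->
  path_sum p a P n h k =
  if P h then chain_sum a (fun _ x => x - p%:Z) (fun r _ => hi r) r h else 0.
Proof.
set N := chain_sum _ _ _.
have N0 s x : ~~ (P x && (x - p%:Z <= s%:Z * p%:Z + k)) -> N s.+1 x = 0.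
  by rewrite -hiP => /negbTE lt_hi; rewrite /N /= int_range0 // big_nil.
have NS s x : P x -> x - p%:Z <= s%:Z * p%:Z + k ->
    N s.+1 x = a (x - p%:Z) * N s (x - p%:Z) + N s.+1 (x + 1).
  move=> Px le_x; rewrite /N /= int_range_cons ?hiP ?Px // big_cons.
  by rewrite addrAC.
elim: n r h => [|n IHn] r h hn /=.
  case: ifP => Ph //=; case: r => [|r] in hn *.
    by have -> : h == k by apply/eqP; lia.
  rewrite N0 ?Ph; first by have -> : (h == k) = false by apply/eqP; nia.
  by apply/negP; nia.
case: ifP => // Ph; case: r => [|r] in hn *.
  rewrite (IHn 0%N) /=; last by lia.
  rewrite (P_le _ Pk); last by lia.
  by rewrite path_sum_low ?mulr0 ?addr0 //; lia.
rewrite (IHn r.+1) ?(IHn r); [|by lia|by lia].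
rewrite (P_le (_ : h - p%:Z <= h) Ph); last by lia.
have -> : (if P (h + 1) then N r.+1 (h + 1) else 0) = N r.+1 (h + 1).
  by case: ifP => // PN; rewrite N0 // PN.
have [le_h|lt_h] := leP (h - p%:Z) (r%:Z * p%:Z + k).
  by rewrite (NS r h) // addrC.
rewrite !N0 ?add0r; [|by apply/negP; lia|by apply/negP; lia].
case: r => [|r] in hn lt_h *; first by lia.
by rewrite N0 ?mulr0 //; apply/negP; lia.
Qed.

End Comparison.

Lemma chain_sum_rev (K : comNzRingType) (p : nat) (a : int -> K) r x :
  chain_sum a (fun _ _ => 0) (fun _ y => y + p%:Z) r x =
  chain_sum (fun y => a (- y - p%:Z)) (fun _ y => y - p%:Z)
    (fun _ _ => - p%:Z) r (- x - p%:Z).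
Proof.
elim: r x => [|r IHr] x //=; rewrite [RHS](big_int_range_rev (- p%:Z)) subrr.
have -> : - p%:Z - (- x - p%:Z - p%:Z) = x + p%:Z by lia.
apply: eq_bigr => i _; rewrite IHr; congr (a _ * chain_sum _ _ _ _ _); lia.
Qed.

Lemma min_height_ge0 (g : vertex * seq vertex) : g.1.2 = 0 ->
  (min_height g = 0) <-> all (fun v => 0 <= v.2) (g.1 :: g.2).
Proof.
case: g => x s /= x0; rewrite x0 lexx /= /min_height /= x0.
have le0 : \big[Num.min/0]_(v <- s) v.2 <= 0 by exact: bigmin_le_id.
have -> : all (fun v => 0 <= v.2) s = (0 <= \big[Num.min/0]_(v <- s) v.2).
  elim: s {le0} => [|v s IHs] /=; first by rewrite big_nil lexx.
  by rewrite big_cons le_min IHs.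
by split=> [->//|ge0]; apply/eqP; rewrite eq_le le0.
Qed.

Lemma max_height_le0 (g : vertex * seq vertex) : (finish g).2 = 0 ->
  (max_height g = 0) <-> all (fun v => v.2 <= 0) (g.1 :: g.2).
Proof.
case: g => x s; rewrite /finish /max_height /= => f0.
have -> : (x.2 <= 0) && all (fun v => v.2 <= 0) s
        = (\big[Num.max/x.2]_(v <- s) v.2 <= 0).
  elim: s {f0} => [|v s IHs] /=; first by rewrite big_nil andbT.
  by rewrite big_cons ge_max -IHs andbCA.
split=> [->//|le0]; apply/eqP; rewrite eq_le le0 /= -f0.
case/lastP: s {le0} f0 => [|s v _]; first by rewrite big_nil.
by rewrite last_rcons le_bigmax_seq // mem_rcons mem_head.
Qed.

Theorem theorem1p5 (K : comNzRingType) (p : nat) (hp : (1 <= p)%N)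
    (a : int -> K) (m j : nat) (hj : (j <= p)%N) :
  [/\ Rpoly p a (m * (p + 1) + j)%N j = Rsum p a m j,
      Spoly p a (m * (p + 1) + j)%N j = Ssum p a m j
    & Tpoly p a (m * (p + 1) + j)%N j = Tsum p a m j].
Proof.
set n := (m * (p + 1) + j)%N.
have nonpos_chain b : path_sum p b (fun x => x <= 0) n (- j%:Z) 0
    = chain_sum b (fun _ y => y - p%:Z) (fun _ _ => - p%:Z) m (- j%:Z).
  rewrite (@path_sum_chain _ _ _ _ _ (fun=> - p%:Z) _ _ _ _ m) //.
  - by rewrite oppr_le0.
  - by move=> x y; exact: le_trans.
  - by move=> r h; apply/idP/andP => [|[]]; nia.
  - by lia.
split.
- rewrite /Rpoly /Rsum (@fsum_paths _ _ _ xpredT n 0 j%:Z); last first.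
    by move=> g; split=> [|[]//] ?; split=> //; apply/allP.
  rewrite (@path_sum_chain _ _ _ _ _ (fun r => r%:Z * p%:Z + j%:Z) _ _ _ _ m) //.
    by symmetry; apply: nested_sumE => s r sm //; congr (_ * _ + _); lia.
  by lia.
- rewrite /Spoly /Ssum (@fsum_paths _ _ _ (fun x => 0 <= x) n 0 j%:Z); last first.
    move=> g; split=> -[gR gm]; split=> //.
      by apply/min_height_ge0 => //; case: gR => _ _ /(congr1 snd).
    by apply/min_height_ge0 => //; case: gR => _ _ /(congr1 snd).
  rewrite path_sum_rev oppr0.
  have -> : (fun x : int => 0 <= - x) = (fun x => x <= 0).
    by apply/funext => x; rewrite oppr_ge0.
  rewrite nonpos_chain.
  rewrite (@nested_sumE _ _ _ _ (fun _ _ => 0) (fun _ y => y + p%:Z)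
    (j%:Z - p%:Z)) // chain_sum_rev; congr chain_sum; lia.
- rewrite /Tpoly /Tsum (@fsum_paths _ _ _ (fun x => x <= 0) n (- j%:Z) 0);
    last first.
    move=> g; split=> -[gR gm]; split=> //.
      by apply/max_height_le0 => //; case: gR => _ _ _ ->.
    by apply/max_height_le0 => //; case: gR => _ _ _ ->.
  by rewrite nonpos_chain; symmetry; apply: nested_sumE.
Qed.
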